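(* Let $T$ have Student's $t$ distribution with $m>4$ degrees of freedom, and let $W=\sqrt{\frac{m-2}{m}}\,T$. Let $h:\mathbb{R}\to\mathbb{R}$ be twice differentiable with absolutely continuous first derivative. Then $$|\mathbb{E}h(W)-\mathbb{E}h(Z)|\leq\frac{2}{m-4}\lVert h''\rVert,$$ where $Z\sim\mathrm{N}(0,1)$.
   Context: $\lVert g\rVert=\sup_{x\in\mathbb{R}}|g(x)|$. Student's $t$ distribution with $m$ degrees of freedom has density proportional to $(1+x^2/m)^{-(m+1)/2}$ for $x\in\mathbb{R}$. *)

(* Defs.v *)
From HB Require Import structures.
From mathcomp Require Import all_boot all_order all_algebra.
From mathcomp Require Import all_classical all_reals all_analysis.

Set Implicit Arguments.
Unset Strict Implicit.
Unset Printing Implicit Defensive.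

Import Order.TTheory GRing.Theory Num.Theory.
Import numFieldNormedType.Exports.

Local Open Scope ring_scope.
Local Open Scope classical_set_scope.

(* Valued in the extended reals: equal to +oo when g is unbounded. *)
Definition supnorm (R : realType) (g : R -> R) : \bar R :=
  ereal_sup (range (fun x => `|g x|%:E)).

Definition abs_continuous_on (R : realType) (a b : R) (f : R -> R) : Prop :=
  forall e : R, 0 < e -> exists2 d : R, 0 < d &
    forall (n : nat) (u v : 'I_n -> R),
      (forall i, [/\ a <= u i, u i <= v i & v i <= b]) ->
      trivIset [set: 'I_n] (fun i => `]u i, v i[%classic) ->
      \sum_i (v i - u i) < d ->
      \sum_i `|f (v i) - f (u i)| < e.

(* On the whole line, absolute continuity means absolute continuity on every
   compact interval, i.e. f is an indefinite integral of a locally integrable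
   function; the uniform version over R is not required. *)
Definition abs_continuous (R : realType) (f : R -> R) : Prop :=
  forall a b : R, abs_continuous_on a b f.

Definition student_kernel (R : realType) (m x : R) : R :=
  (1 + x ^+ 2 / m) `^ (- ((m + 1) / 2)).

(* The constant c is determined by P setT = 1. *)
Definition student_distributed d (Omega : measurableType d) (R : realType)
    (P : probability Omega R) (m : R) (T : {RV P >-> R}) : Prop :=
  exists2 c : R, 0 < c &
    forall A : set R, measurable A ->
      distribution P T A =
        (\int[lebesgue_measure]_(x in A) (c * student_kernel m x)%:E)%E.

(* The two set functions are compared on measurable sets only: off them the
   value of normal_prob is an artefact of its definition as an integral. *)
Definition std_normal_distributed d (Omega : measurableType d) (R : realType)
    (P : probability Omega R) (Z : {RV P >-> R}) : Prop :=
  forall A : set R, measurable A -> distribution P Z A = normal_prob 0 1 A.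

(* Main.v *)
Require Import Defs.
From HB Require Import structures.
From mathcomp Require Import all_boot all_order all_algebra.
From mathcomp Require Import all_classical all_reals all_analysis.
From mathcomp Require Import measurable_realfun.
From mathcomp Require Import ring lra.

Set Implicit Arguments.
Unset Strict Implicit.
Unset Printing Implicit Defensive.

Import Order.TTheory GRing.Theory Num.Theory.
Import numFieldNormedType.Exports.

Local Open Scope ring_scope.
Local Open Scope classical_set_scope.

(** The proof is Stein's method with a Stein kernel.  Put K = ||h''||, assumed
    finite, and b = E h(Z).

    - Gaussian side.  The Stein equation f' - x f = h - b is solved by
      f = phi^-1 * int_(-oo)^x (h - b) phi.  Differentiating it twice shows that
      v = f' satisfies v'' - x v' - 2 v = h''.  At a maximum of v one has v' = 0
      and v'' <= 0, hence 2 v <= K; this is the bound |f'| <= K / 2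
      (gauss_stein_derivative_bound).  As the line is not compact, the maximum
      is taken for v - e x^4, which is legitimate because f grows at most
      linearly (gauss_stein_solution) and hence v at most quadratically.

    - Student side.  The density of W satisfies (tau p)' = - x p for the
      quadratic Stein kernel tau(x) = (m - 2 + x^2) / (m - 1), so integrating
      the derivative of tau p f gives E [tau(W) f'(W) - W f(W)] = 0
      (student_stein).  The choice f = id gives E W^2 = 1.

    Subtracting the two identities,
      E h(W) - b = E [f'(W) (1 - tau(W))] = E [f'(W) (1 - W^2)] / (m - 1),
    whose absolute value is at most
      (K / 2) (1 + E W^2) / (m - 1) = K / (m - 1) <= 2 K / (m - 4).
    The constant obtained on the way, K / (m - 1), is the better one
    (student_normal_distance). *)

(** * Integrals over the line *)

Section integrals_on_the_line.
Context {R : realType}.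
Notation mu := (@lebesgue_measure R).
Implicit Types (f g G : R -> R).

Lemma cvg_Rintegral_set (g : R -> R) (A : nat -> set R) (B : set R) :
  (forall n, measurable (A n)) -> measurable B ->
  mu.-integrable setT (EFin \o g) ->
  (forall x, \forall n \near \oo, A n x <-> B x) ->
  \int[mu]_(x in A n) g x @[n --> \oo] --> \int[mu]_(x in B) g x.
Proof.
move=> mA mB ig AB.
have mg : measurable_fun setT g by apply/measurable_EFinP; exact: measurable_int ig.
have mgr D : measurable D -> measurable_fun setT (EFin \o (g \_ D)).
  move=> mD; apply/measurable_EFinP; apply/(measurable_restrictT g) => //.
  exact: measurable_funTS.
have := @dominated_convergence _ _ _ mu setT measurableT
  (fun n => EFin \o (g \_ (A n))) (EFin \o (g \_ B)) (EFin \o (Num.norm \o g)).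
case.
- by move=> n; exact: mgr.
- exact: mgr.
- apply: aeW => x _; apply: cvg_near_cst; apply: filterS (AB x) => n ABn /=.
  rewrite /patch; congr (_%:E).
  have -> : (x \in A n) = (x \in B) by apply/idP/idP; rewrite !inE => /ABn.
  by [].
- exact: integrable_norm.
- apply: aeW => x n _ /=; rewrite /patch.
  by case: ifP => _; rewrite ?lee_fin ?normr0.
move=> ifB _ /= cv.
rewrite Rintegral_mkcond.
under eq_fun do rewrite Rintegral_mkcond.
apply: fine_cvg; rewrite fineK; last exact: (integrable_fin_num measurableT ifB).
exact: cv.
Qed.

Lemma cvg_Rintegral_itvNy_y g : mu.-integrable setT (EFin \o g) ->
  \int[mu]_(t in `]-oo, x]) g t @[x --> +oo] --> \int[mu]_t g t.
Proof.
move=> ig; apply/cvg_pinftyP => u uy.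
apply: cvg_Rintegral_set => // x.
move/cvgryPge : uy => /(_ x); apply: filterS => n xn.
by rewrite /= in_itv/= xn.
Qed.

Lemma cvg_Rintegral_itvNy_Ny g : mu.-integrable setT (EFin \o g) ->
  \int[mu]_(t in `]-oo, x]) g t @[x --> -oo] --> 0.
Proof.
move=> ig; apply/cvg_ninftyP => u uy.
rewrite -(Rintegral_set0 mu g).
apply: cvg_Rintegral_set => // x.
move/cvgrNyPlt : uy => /(_ x); apply: filterS => n xn.
by rewrite /= in_itv/= leNgt xn.
Qed.

Lemma is_derive_Rintegral_itvNy g : mu.-integrable setT (EFin \o g) ->
  continuous g -> forall x : R,
  is_derive x 1 (fun y : R => \int[mu]_(t in `]-oo, y]) g t) (g x).
Proof.
move=> ig cg x.
have xx1 : x < x + 1 by rewrite ltrDl.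
have igx : mu.-integrable `]-oo, x + 1] (EFin \o g) by exact: integrableS ig.
have [] := continuous_FTC1 xx1 igx (ltNyr _) (cg x).
by move=> dF <-; rewrite derive1E; exact: derivableP.
Qed.

(** The primitive of g vanishing at -oo differs from G by a constant, and the
    limits at -oo show that the constant is 0; the limit at +oo of that
    primitive is the integral. *)
Lemma Rintegral_derive_eq0 g G : (forall x : R, is_derive x 1 G (g x)) ->
  continuous g -> mu.-integrable setT (EFin \o g) ->
  G x @[x --> +oo] --> 0 -> G x @[x --> -oo] --> 0 ->
  \int[mu]_x g x = 0.
Proof.
move=> dG cg ig Gy GNy.
pose H x := \int[mu]_(t in `]-oo, x]) g t - G x.
have dH (x : R) : is_derive x 1 H 0.
  rewrite -(subrr (g x)); apply: is_deriveB.
  exact: is_derive_Rintegral_itvNy.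
have HNy : H x @[x --> -oo] --> 0.
  rewrite -[0](subrr 0); apply: cvgB => //; exact: cvg_Rintegral_itvNy_Ny.
have Hy : H x @[x --> +oo] --> \int[mu]_x g x.
  rewrite -[X in _ --> X]subr0; apply: cvgB => //; exact: cvg_Rintegral_itvNy_y.
have Hc : H = cst (H 0) by apply/funext => x; exact: is_derive_0_is_cst.
rewrite Hc in HNy Hy.
rewrite -(cvg_lim _ Hy)// -[RHS](cvg_lim _ HNy)//.
by rewrite !lim_cst.
Qed.

End integrals_on_the_line.

(** * Expectations through a density *)

Section expectation_density.
Context {R : realType} d (Omega : measurableType d) (P : probability Omega R).
Notation mu := (@lebesgue_measure R).
Variables (X : {RV P >-> R}) (p : R -> R).
Hypotheses (p0 : forall x, 0 <= p x) (ip : mu.-integrable setT (EFin \o p)).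
Hypothesis Xp : forall A : set R, measurable A ->
  distribution P X A = (\int[mu]_(x in A) (p x)%:E)%E.

Let mp : measurable_fun setT (EFin \o p).
Proof. exact: measurable_int ip. Qed.

(* The codomain is given the display of the Borel sets that Lebesgue measure
   carries; domination is stated between measures of one display. *)
Let X' : Omega -> measurableTypeR R := X.

Let mX' : measurable_fun setT X'.
Proof. exact: (measurable_funPT X). Qed.

#[local] HB.instance Definition _ := isMeasurableFun.Build _ _ _ _ X' mX'.

Let nu := distribution P X'.

Let dom : nu `<< mu.
Proof.
apply/null_content_dominatesP => A mA A0; rewrite [LHS]Xp//.
by apply: null_set_integral => //; exact: measurable_funTS.
Qed.

(** By hypothesis p is a Radon-Nikodym derivative of the law of X, and such a
    derivative is unique almost everywhere. *)
Lemma ge0_integral_density (f : R -> \bar R) :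
  measurable_fun setT f -> (forall x, 0 <= f x)%E ->
  (\int[P]_w f (X w) = \int[mu]_x (f x * (p x)%:E))%E.
Proof.
move=> mf f0.
transitivity (\int[nu]_x f x)%E; first by rewrite ge0_integral_distribution.
rewrite -(Radon_Nikodym_SigmaFinite.change_of_variables dom)//.
apply: ae_eq_integral => //.
- apply: emeasurable_funM => //.
  exact: measurable_int (Radon_Nikodym_SigmaFinite.f_integrable dom).
- exact: emeasurable_funM.
- apply: ae_eqe_mul2l; apply: integral_ae_eq => //.
    exact: Radon_Nikodym_SigmaFinite.f_integrable.
  by move=> E _ mE; rewrite -Radon_Nikodym_SigmaFinite.f_integral//; exact: Xp.
Qed.

(** As p is nonnegative, the positive and negative parts of h p are those of h
    multiplied by p, which reduces the claim to nonnegative functions. *)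
Lemma expectation_density (h : R -> R) : measurable_fun setT h ->
  mu.-integrable setT (EFin \o (h \* p)) ->
  ('E_P[h \o X] = (\int[mu]_x (h x * p x))%R%:E)%E.
Proof.
move=> mh ihp.
have mEh : measurable_fun setT (EFin \o h) by exact/measurable_EFinP.
rewrite unlock /Rintegral fineK; last first.
  exact: (integrable_fin_num measurableT ihp).
have pos (g : R -> R) (x : R) :
    (((EFin \o (g \* p)%R)^\+) x = ((EFin \o g)^\+) x * (p x)%:E)%E.
  by rewrite !funeposE/= maxe_pMl ?lee_fin// mul0e.
have neg (g : R -> R) (x : R) :
    (((EFin \o (g \* p)%R)^\-) x = ((EFin \o g)^\-) x * (p x)%:E)%E.
  by rewrite !funenegE/= maxe_pMl ?lee_fin// mul0e -EFinM mulNr.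
rewrite [LHS]integralE [RHS]integralE.
under [in RHS]eq_integral do rewrite pos.
under [X in _ = (_ - X)%E]eq_integral do rewrite neg.
rewrite -!ge0_integral_density//.
- by congr (_ - _)%E; apply: eq_integral => w _; rewrite ?funeposE ?funenegE.
- exact: measurable_funeneg.
- exact: measurable_funepos.
Qed.

End expectation_density.

(** * Derivatives and a maximum principle *)

Section calculus.
Context {R : realType}.
Implicit Types (f g v : R -> R).

Lemma quadratic_bound_ge0 g (C : R) :
  (forall x, `|g x| <= C * (1 + x ^+ 2)) -> 0 <= C.
Proof. by move=> /(_ 0); rewrite expr0n/= addr0 mulr1; exact: le_trans. Qed.

(** The product rules are needed for explicit lambda-terms, which do not unify
    with products in the ring of functions. *)
Lemma is_derive1M f g (x a b : R) : is_derive x 1 f a -> is_derive x 1 g b ->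
  is_derive x 1 (fun y => f y * g y) (a * g x + f x * b).
Proof.
move=> Df Dg; apply: (@is_derive_eq _ _ _ (f * g)).
by rewrite /GRing.scale/=; ring.
Qed.

Lemma is_derive1Xn n (x : R) :
  is_derive x 1 (fun y : R => y ^+ n.+1) (n.+1%:R * x ^+ n).
Proof.
elim: n => [|n IH]; first by rewrite expr0 mulr1; exact: is_derive_id.
have := is_derive1M (is_derive_id x 1) IH.
rewrite (_ : 1 * _ + _ = n.+2%:R * x ^+ n.+1).
  by under eq_fun do rewrite -exprS.
by rewrite !exprS -[n.+2]addn1 natrD; ring.
Qed.

Lemma is_derive1Ml f (k x a : R) : is_derive x 1 f a ->
  is_derive x 1 (fun y => k * f y) (k * a).
Proof. by move=> Df; apply: (@is_derive_eq _ _ _ (k \*: f)). Qed.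

Lemma is_derive_continuous f (df : R -> R) :
  (forall x : R, is_derive x 1 f (df x)) -> continuous f.
Proof.
move=> Df x; apply: differentiable_continuous.
by apply/derivable1_diffP; have [] := Df x.
Qed.

Lemma le_dist_derive f (df : R -> R) (K : R) :
  (forall x : R, is_derive x 1 f (df x)) ->
  forall a b, (forall x, `|x - a| <= `|b - a| -> `|df x| <= K) ->
  `|f b - f a| <= K * `|b - a|.
Proof.
move=> Df a b Kf.
have cf := is_derive_continuous Df.
have [ab|ab] := leP a b.
  have [c /[!in_itv]/= /andP[ac cb] ->] := @MVT_segment _ f df a b ab
    (fun x _ => Df x) (continuous_subspaceT cf).
  rewrite normrM ler_wpM2r// Kf// !ger0_norm ?subr_ge0//.
  by rewrite lerD2r.
have [c /[!in_itv]/= /andP[bc ca]] := @MVT_segment _ f df b a (ltW ab)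
  (fun x _ => Df x) (continuous_subspaceT cf).
rewrite -(distrC (f a)) -(distrC a b) => ->.
rewrite normrM ler_wpM2r// Kf// distrC (distrC b) !ger0_norm ?subr_ge0//.
  by rewrite lerD2l lerN2.
exact: ltW.
Qed.

(** If v2 > 0 then v1, which vanishes at c, is positive just to the right of c,
    and v would increase there. *)
Lemma derive2_at_max v (v1 : R -> R) (v2 a b c : R) :
  c \in `]a, b[%R -> (forall x : R, is_derive x 1 v (v1 x)) ->
  is_derive c 1 v1 v2 -> (forall t, t \in `]a, b[%R -> v t <= v c) ->
  v1 c = 0 /\ v2 <= 0.
Proof.
move=> cab Dv Dv1 vmax.
have /andP[ac cb] : a < c < b by move: cab; rewrite in_itv.
have v1c : v1 c = 0.
  have := derive1_at_max (ltW (lt_trans ac cb)) (fun t _ => @ex_derive _ _ _ _ _ _ _ (Dv t)) cab vmax.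
  by move=> /(@derive_val) <-; rewrite (@derive_val _ _ _ _ _ _ _ (Dv c)).
split=> //; rewrite leNgt; apply/negP => v20.
have /is_derive1_caratheodory[g [vg cg gc]] := Dv1.
have [e e0 ge] : exists2 e : R, 0 < e & forall t, `|c - t| < e -> 0 < g t.
  have /cvgrPdist_lt/(_ v2 v20) [e /= e0 he] := cg.
  exists e => // t te; have := he t te; rewrite gc ltr_norml => /andP[_].
  by rewrite ltrBlDl ltrDr.
pose t := c + Num.min (e / 2) ((b - c) / 2).
have t0 : 0 < t - c by rewrite /t addrC addKr lt_min !divr_gt0 ?subr_gt0.
have te : t - c < e.
  by rewrite /t addrC addKr gt_min; apply/orP; left; rewrite ltr_pdivrMr// mulr_natr mulr2n ltrDl.
have tb : t < b.
  rewrite -(ltrD2r (- c)) {1}/t addrC addKr gt_min; apply/orP; right.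
  by rewrite ltr_pdivrMr// mulr_natr mulr2n ltrDl subr_gt0.
have ct : c < t by rewrite -subr_gt0.
have [x /[!in_itv]/= /andP[cx xt] vtc] := MVT ct (fun x _ => Dv x)
  (continuous_subspaceT (is_derive_continuous Dv)).
have : v t <= v c by apply: vmax; rewrite in_itv/= tb (lt_trans ac).
rewrite -subr_le0 vtc leNgt => /negP; apply.
have v1x : v1 x = g x * (x - c) by rewrite -vg v1c subr0.
rewrite mulr_gt0// v1x mulr_gt0 ?subr_gt0//.
apply: ge; rewrite ltr0_norm ?subr_lt0// opprB.
by apply: lt_trans te; rewrite ltrD2r.
Qed.

(** Maximum principle for v'' - x v' - 2 v = k on the whole line.  The barrier
    e x^4 forces v - e x^4 to have a maximum c.  There v' = 4 e c^3 and
    v'' <= 12 e c^2, so the equation gives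
    2 v(c) <= K + e (12 c^2 - 4 c^4) <= K + 9 e.  Then e tends to 0. *)
Lemma ode_max_principle v (v1 v2 k : R -> R) (K C : R) :
  (forall x : R, is_derive x 1 v (v1 x)) ->
  (forall x : R, is_derive x 1 v1 (v2 x)) ->
  (forall x, v2 x = x * v1 x + 2 * v x + k x) ->
  (forall x, `|k x| <= K) ->
  (forall x, `|v x| <= C * (1 + x ^+ 2)) ->
  forall x, v x <= K / 2.
Proof.
move=> Dv Dv1 ode kK vC x.
have C0 := quadratic_bound_ge0 vC.
have K0 : 0 <= K by exact: le_trans (kK 0).
suff barrier (e : R) : 0 < e -> v x <= K / 2 + e * (x ^+ 4 + 5).
  apply/ler_addgt0Pr => e e0.
  have x5 : 0 < x ^+ 4 + 5 by rewrite ltr_wpDl// exprn_even_ge0.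
  by have := barrier (e / (x ^+ 4 + 5)) (divr_gt0 e0 x5); rewrite divfK ?gt_eqF.
move=> e0.
pose w t := v t - e * t ^+ 4.
pose w1 t := v1 t - e * (4 * t ^+ 3).
have Dw (t : R) : is_derive t 1 w (w1 t).
  exact: is_deriveB (is_derive1Ml e (is_derive1Xn 3 t)).
have Dw1 (t : R) : is_derive t 1 w1 (v2 t - e * (12 * t ^+ 2)).
  rewrite (_ : 12 * t ^+ 2 = 4 * (3 * t ^+ 2)); last by ring.
  exact: is_deriveB (is_derive1Ml e (is_derive1Ml 4 (is_derive1Xn 2 t))).
(* Outside [-N, N] the barrier e t^4 dominates the quadratic growth of v. *)
pose N := 1 + `|x| + 2 * C / e.
have Ce : 0 <= 2 * C / e by rewrite divr_ge0 ?(ltW e0)// mulr_ge0.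
have N1 : 1 <= N by rewrite /N -addrA lerDl addr_ge0.
have NC : 2 * C <= e * N.
  have : e * (2 * C / e) <= e * N by rewrite ler_pM2l// lerDr addr_ge0.
  by rewrite mulrC divfK ?gt_eqF.
have xN : `|x| <= N.
  by rewrite /N addrAC lerDr addr_ge0.
have NN : - N <= N by move: N1; lra.
have wN t : `|t| = N -> w t <= 0.
  move=> tN; rewrite subr_le0 (le_trans (ler_norm _))// (le_trans (vC t))//.
  have t2 : t ^+ 2 = N ^+ 2 by rewrite -tN real_normK ?num_real.
  rewrite (_ : t ^+ 4 = (t ^+ 2) ^+ 2); last by ring.
  rewrite t2; have N0 : 0 <= N by exact: le_trans N1.
  have h1 : 0 <= C * (N ^+ 2 - 1) by rewrite mulr_ge0// subr_ge0 expr_ge1.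
  have h2 : 0 <= (e * N - 2 * C) * N ^+ 2 by rewrite mulr_ge0 ?subr_ge0 ?sqr_ge0.
  have h3 : 0 <= e * N ^+ 3 * (N - 1).
    by rewrite mulr_ge0 ?subr_ge0// mulr_ge0 ?exprn_ge0// ltW.
  move: h1 h2 h3; clear; lra.
have [c cN wmax] := EVT_max NN (continuous_subspaceT (is_derive_continuous Dw)).
have wx : w x <= w c by apply: wmax; rewrite in_itv/= -ler_norml.
suff wc : w c <= K / 2 + e * 5.
  by rewrite -(lerD2r (- (e * x ^+ 4))) (le_trans wx)// (le_trans wc)//; lra.
have pos : 0 <= K / 2 + e * 5 by lra.
have [|cN'] := eqVneq (`|c|) N; first by move/wN => /le_trans; apply.
have cNN : c \in `]- N, N[%R.
  rewrite in_itv/= -ltr_norml lt_neqAle cN'/= ler_norml.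
  by move: cN; rewrite in_itv.
have wmax' t : t \in `]- N, N[%R -> w t <= w c.
  by move=> tN; apply: wmax; exact: subset_itv_oo_cc tN.
have [w1c w2c] := derive2_at_max cNN Dw (Dw1 c) wmax'.
have := ode c; have := kK c; rewrite ler_norml => /andP[kc _].
move: w1c w2c; rewrite /w1 /w; clear -kc K0 e0.
move=> /eqP; rewrite subr_eq0 => /eqP -> v2c odec.
(* This square is 9 - 12 c^2 + 4 c^4. *)
have c4 : 0 <= (2 * c ^+ 2 - 3) ^+ 2 by exact: sqr_ge0.
have c40 : 0 <= e * c ^+ 4 by rewrite mulr_ge0 ?(ltW e0)// exprn_even_ge0.
have : 0 <= e * (9 - 12 * c ^+ 2 + 4 * c ^+ 4).
  rewrite mulr_ge0 ?(ltW e0)//; move: c4; lra.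
move: c40 odec v2c kc; lra.
Qed.

End calculus.

(** * Decay at infinity *)

Section decay.
Context {R : realType}.
Notation mu := (@lebesgue_measure R).
Implicit Types (f g : R -> R).

Lemma integrable_oneDsqrV :
  mu.-integrable setT (EFin \o (fun x : R => (1 + x ^+ 2)^-1)).
Proof.
have c1 : continuous (fun x : R => (1 + x ^+ 2)^-1) := @continuous_oneDsqrV R.
have m1 := continuous_measurable_fun c1.
have p1 (x : R) : 0 <= (1 + x ^+ 2)^-1.
  by rewrite invr_ge0 addr_ge0 ?sqr_ge0.
apply/integrableP; split; first exact/measurable_EFinP.
under eq_integral do rewrite /= ger0_norm//.
rewrite ge0_symfun_integralT//; last by move=> x /=; rewrite sqrrN.
rewrite (_ : [set x | 0 <= x] = `[0, +oo[%classic); last first.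
  by apply/seteqP; split => x /=; rewrite in_itv/= andbT.
by rewrite integral0y_oneDsqr -EFinM ltry.
Qed.

Lemma integrable_le_oneDsqrV f (C : R) : continuous f ->
  (forall x, `|f x| * (1 + x ^+ 2) <= C) -> mu.-integrable setT (EFin \o f).
Proof.
move=> cf fC; have mf := continuous_measurable_fun cf.
have p1 (x : R) : 0 < 1 + x ^+ 2 by rewrite ltr_wpDr ?sqr_ge0.
apply: (@le_integrable _ _ _ mu setT measurableT _
  (fun x => (C%:E * ((1 + x ^+ 2)^-1)%:E)%E)).
- exact/measurable_EFinP.
- move=> x _; rewrite /= lee_fin.
  apply: le_trans (ler_norm _).
  by rewrite -ler_pdivrMr ?invr_gt0// invrK.
- exact: integrableZl integrable_oneDsqrV.
Qed.

(** Both densities of interest decay at least like x^-4, which makes them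
    integrable against functions of quadratic growth. *)
Lemma integrableM_quartic_decay (p g : R -> R) (C D : R) :
  continuous p -> (forall x, 0 <= p x) ->
  (forall x, p x * (1 + x ^+ 2) ^+ 2 <= D) ->
  continuous g -> (forall x, `|g x| <= C * (1 + x ^+ 2)) ->
  mu.-integrable setT (EFin \o (g \* p)).
Proof.
move=> cp p0 pD cg gC; have C0 := quadratic_bound_ge0 gC.
apply: (@integrable_le_oneDsqrV _ (C * D)).
  by move=> x; apply: cvgM; [exact: cg|exact: cp].
move=> x; rewrite normrM (ger0_norm (p0 x)).
apply: le_trans (ler_wpM2l C0 (pD x)).
have s0 : 0 <= p x * (1 + x ^+ 2) by rewrite mulr_ge0 ?addr_ge0 ?sqr_ge0.
have := ler_wpM2r s0 (gC x); rewrite !mulrA => /le_trans; apply.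
by rewrite -!mulrA [(1 + _) * (p x * _)]mulrCA expr2.
Qed.

Lemma cvg0_le_normM f (C : R) : (forall x, `|f x| * `|x| <= C) ->
  f x @[x --> +oo] --> 0 /\ f x @[x --> -oo] --> 0.
Proof.
move=> fC.
have C0 : 0 <= C by apply: le_trans (fC 0); rewrite mulr_ge0.
have small (e x : R) : 0 < e -> C / e + 1 <= `|x| -> `|0 - f x| < e.
  move=> e0 xC; rewrite sub0r normrN.
  have x0 : 0 < `|x| by rewrite (lt_le_trans _ xC)// ltr_wpDl// divr_ge0// ltW.
  rewrite -(ltr_pM2r x0) (le_lt_trans (fC x))// -ltr_pdivrMl// mulrC.
  by rewrite (lt_le_trans _ xC)// ltrDl.
split; apply/cvgrPdist_lt => e e0.
  near=> x; apply: small => //; apply: le_trans (ler_norm _).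
  by near: x; exact: nbhs_pinfty_ge (num_real _).
near=> x; apply: small => //; rewrite -normrN; apply: le_trans (ler_norm _).
by rewrite lerNr; near: x; exact: nbhs_ninfty_le (num_real _).
Unshelve. all: by end_near. Qed.

End decay.

(** * The Gaussian Stein equation *)

Section gaussian.
Context {R : realType}.
Notation mu := (@lebesgue_measure R).
Notation phi := (@normal_pdf R 0 1).
Implicit Types (f q F : R -> R).

Lemma std_normal_pdfE (x : R) :
  phi x = normal_peak 1 * expR (- (x ^+ 2 / 2)).
Proof.
rewrite normal_pdfE ?oner_neq0// /normal_fun subr0 expr1n mulNr.
by rewrite -[1 *+ 2]mulr_natr mul1r.
Qed.

Lemma std_normal_pdf_gt0 (x : R) : 0 < phi x.
Proof. by rewrite std_normal_pdfE mulr_gt0 ?normal_peak_gt0 ?oner_neq0 ?expR_gt0. Qed.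

Lemma is_derive_std_normal_pdf (x : R) : is_derive x 1 phi (- (x * phi x)).
Proof.
have -> : phi = (fun y => normal_peak 1 * expR (- 2^-1 * y ^+ 2)).
  by apply/funext => y; rewrite std_normal_pdfE; congr (_ * expR _); ring.
have Dsq := is_derive1Ml (- 2^-1) (is_derive1Xn 1 x).
have Dexp := is_derive1_comp (is_derive_expR _) Dsq.
by apply: is_derive_eq (is_derive1Ml (normal_peak 1) Dexp) _; rewrite /=; field.
Qed.

(** Square of e^(x^2/4) >= 1 + x^2/4 >= (1 + x^2)/4. *)
Lemma std_normal_pdf_decay (x : R) :
  phi x * (1 + x ^+ 2) ^+ 2 <= 16 * normal_peak 1.
Proof.
have peak0 : 0 < normal_peak (1 : R) by rewrite normal_peak_gt0 ?oner_neq0.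
rewrite std_normal_pdfE -mulrA mulrC ler_pM2r//.
have e4 : (1 + x ^+ 2) / 4 <= expR (x ^+ 2 / 4).
  by apply: le_trans (expR_ge1Dx _); have := sqr_ge0 x; lra.
rewrite expRN ler_pdivrMl ?expR_gt0//.
have -> : expR (x ^+ 2 / 2) = expR (x ^+ 2 / 4) ^+ 2.
  by rewrite [RHS]expr2 -expRD; congr expR; lra.
rewrite (_ : 16 = 4 ^+ 2); last by rewrite -natrX.
rewrite -exprMn lerXn2r ?nnegrE ?mulr_ge0 ?expR_ge0 ?addr_ge0 ?sqr_ge0//.
by rewrite -ler_pdivrMr.
Qed.

Lemma integrableM_std_normal_pdf q (B : R) : continuous q ->
  (forall x, `|q x| <= B * (1 + x ^+ 2)) ->
  mu.-integrable setT (EFin \o (q \* phi)).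
Proof.
move=> cq qB; apply: integrableM_quartic_decay cq qB.
- by apply: continuous_normal_pdf; rewrite oner_neq0.
- by move=> x; exact: ltW (std_normal_pdf_gt0 x).
- exact: std_normal_pdf_decay.
Qed.

(** Comparison with the explicit function x phi, of derivative (1 - x^2) phi:
    for x >= 2 one has 1 + x^2 <= 2 (x^2 - 1), so F - 2 B x phi is nondecreasing
    there; as it tends to 0 at infinity, it is nonpositive. *)
Lemma gauss_tail_le F q (B : R) :
  (forall x : R, is_derive x 1 F (q x * phi x)) ->
  (forall x, `|q x| <= B * (1 + x ^+ 2)) ->
  F x @[x --> +oo] --> 0 ->
  forall x, 2 <= x -> F x <= 2 * B * x * phi x.
Proof.
move=> DF qB Fy x x2.
have B0 := quadratic_bound_ge0 qB.
pose S y := F y - 2 * B * (y * phi y).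
pose dS y := (q y + 2 * B * (y ^+ 2 - 1)) * phi y.
have DS (y : R) : is_derive y 1 S (dS y).
  rewrite (_ : dS y = q y * phi y - 2 * B * (1 * phi y + y * (- (y * phi y)))).
    apply: is_deriveB; apply: is_derive1Ml; apply: is_derive1M.
    exact: is_derive_std_normal_pdf.
  by rewrite /dS; ring.
have dS0 y : 2 <= y -> 0 <= dS y.
  move=> y2; rewrite mulr_ge0 ?(ltW (std_normal_pdf_gt0 _))//.
  have := qB y; rewrite ler_norml => /andP[+ _].
  have : 0 <= B * (y ^+ 2 - 3).
    by rewrite mulr_ge0// subr_ge0; nra.
  lra.
have Sy : S y @[y --> +oo] --> 0.
  rewrite -[X in _ --> X](subr0 0) -[X in _ --> (_ - X)](mulr0 (2 * B)).
  apply: cvgB => //; apply: cvgM; first exact: cvg_cst.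
  apply: (cvg0_le_normM (C := 16 * normal_peak 1) _).1 => y.
  rewrite normrM (ger0_norm (ltW (std_normal_pdf_gt0 y))).
  apply: le_trans (std_normal_pdf_decay y).
  rewrite mulrAC -expr2 real_normK ?num_real// mulrC.
  rewrite ler_wpM2l ?(ltW (std_normal_pdf_gt0 y))//.
  by have := sqr_ge0 y; nra.
have : S x <= 0.
  rewrite -(cvg_lim _ Sy)//; apply: limr_ge; first by apply/cvg_ex; exists 0.
  near=> y; have xy : x <= y by near: y; exact: nbhs_pinfty_ge (num_real _).
  have [z /[!in_itv]/= /andP[xz _] SyE] := MVT_segment xy (fun y _ => DS y)
    (continuous_subspaceT (is_derive_continuous DS)).
  by rewrite -subr_ge0 SyE mulr_ge0 ?subr_ge0// dS0// (le_trans x2).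
by rewrite subr_le0 !mulrA.
Unshelve. all: by end_near. Qed.

(** The quotient by phi of the primitive F of q phi vanishing at -oo.  Since the
    integral of q phi is 0, F also vanishes at +oo; the tail comparison then
    applies on both sides, to F and to its reflection, and gives linear growth
    of F / phi for |x| >= 2. *)
Lemma gauss_stein_solution q (B : R) : continuous q ->
  (forall x, `|q x| <= B * (1 + x ^+ 2)) -> \int[mu]_x (q x * phi x) = 0 ->
  exists f (C : R), (forall x : R, is_derive x 1 f (q x + x * f x)) /\
    (forall x, `|f x| <= C * (1 + `|x|)).
Proof.
move=> cq qB q0.
have B0 := quadratic_bound_ge0 qB.
have iq : mu.-integrable setT (EFin \o (q \* phi)).
  exact: integrableM_std_normal_pdf qB.
have cqphi : continuous (q \* phi).
  move=> x; apply: cvgM; first exact: cq.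
  by apply: continuous_normal_pdf; rewrite oner_neq0.
pose F x := \int[mu]_(t in `]-oo, x]) (q \* phi) t.
have DF (x : R) : is_derive x 1 F (q x * phi x).
  exact: is_derive_Rintegral_itvNy.
have Fy : F x @[x --> +oo] --> 0.
  by rewrite -[X in _ --> X]q0; exact: cvg_Rintegral_itvNy_y.
have FNy : F x @[x --> -oo] --> 0 by exact: cvg_Rintegral_itvNy_Ny.
have phiN x : phi (- x) = phi x by rewrite !std_normal_pdfE sqrrN.
have phi0 x := std_normal_pdf_gt0 x.
have norm_tail G p : (forall x : R, is_derive x 1 G (p x * phi x)) ->
    (forall x, `|p x| <= B * (1 + x ^+ 2)) -> G x @[x --> +oo] --> 0 ->
    forall x, 2 <= x -> `|G x| <= 2 * B * x * phi x.
  move=> DG pB Gy x x2; rewrite ler_norml; apply/andP; split; last first.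
    exact: gauss_tail_le pB Gy _ x2.
  rewrite lerNl; apply: (@gauss_tail_le (fun y => - G y) (fun y => - p y)) => //.
  - by move=> y; rewrite mulNr; exact: is_deriveN.
  - by move=> y; rewrite normrN.
  - by rewrite -[X in _ --> X]oppr0; exact: cvgN.
have Ftail x : 2 <= `|x| -> `|F x| <= 2 * B * `|x| * phi x.
  have [x0|x0] := ger0P x.
    by move=> x2; exact: (norm_tail F q).
  move=> x2; rewrite -{1}(opprK x) -phiN.
  apply: (norm_tail (F \o -%R) (fun y => - q (- y))) => //.
  - move=> y; rewrite mulNr -phiN -mulrN1.
    exact: is_derive1_comp (DF (- y)) (is_deriveNid y 1).
  - by move=> y; rewrite normrN -(sqrrN y).
  - exact/cvgNy_compNP.
pose f x := F x * (phi x)^-1.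
have Df (x : R) : is_derive x 1 f (q x + x * f x).
  have phix : phi x != 0 by rewrite gt_eqF.
  apply: is_derive_eq.
    apply: is_derive1M; apply: is_deriveV phix _.
    exact: is_derive_std_normal_pdf.
  by rewrite /f /GRing.scale/=; field.
have cf : continuous (fun x => `|f x|).
  by move=> x; apply: cvg_norm; exact: is_derive_continuous Df x.
have [c _ cmax] := @EVT_max _ _ (- 2) 2 ltac:(lra) (continuous_subspaceT cf).
exists f, (`|f c| + 2 * B); split=> // x.
have [x2|/ltW x2] := leP (`|x|) 2.
  have := cmax x; rewrite in_itv/= -ler_norml => /(_ x2).
  have := normr_ge0 (f c); have := normr_ge0 x; nra.
have fx : `|f x| <= 2 * B * `|x|.
  by rewrite normrM normfV (gtr0_norm (phi0 x)) ler_pdivrMr// Ftail.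
have := normr_ge0 (f c); have := normr_ge0 x; nra.
Qed.

End gaussian.

Section stein_bound.
Context {R : realType}.
Notation mu := (@lebesgue_measure R).
Notation phi := (@normal_pdf R 0 1).

Lemma quadratic_growth (h h1 h2 : R -> R) (K : R) :
  (forall x : R, is_derive x 1 h (h1 x)) ->
  (forall x : R, is_derive x 1 h1 (h2 x)) ->
  (forall x, `|h2 x| <= K) ->
  forall x, `|h x| <= (`|h 0| + `|h1 0| + K) * (1 + x ^+ 2).
Proof.
move=> Dh Dh1 hK x.
have K0 : 0 <= K by exact: le_trans (hK 0).
have h1x y : `|h1 y| <= `|h1 0| + K * `|y|.
  have := le_dist_derive Dh1 (a := 0) (b := y) (fun z _ => hK z).
  rewrite subr0; have := ler_normD (h1 y - h1 0) (h1 0); rewrite subrK; lra.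
have := @le_dist_derive _ _ _ (`|h1 0| + K * `|x|) Dh 0 x.
rewrite subr0 => /(_ _)/wrap[y|].
  rewrite subr0 => yx; apply: le_trans (h1x y) _.
  by rewrite lerD2l ler_wpM2l.
have := ler_normD (h x - h 0) (h 0); rewrite subrK.
rewrite -[x ^+ 2]real_normK ?num_real//.
have := normr_ge0 x; have := normr_ge0 (h 0); have := normr_ge0 (h1 0).
move: (`|x|) (`|h 0|) (`|h1 0|) (`|h x|) (`|h x - h 0|) => X A B E D B0 A0 X0 E1 E2.
have : 0 <= A * X ^+ 2 by rewrite mulr_ge0 ?sqr_ge0.
have : 0 <= B * (X - 1) ^+ 2 by rewrite mulr_ge0 ?sqr_ge0.
have : 0 <= B * X by rewrite mulr_ge0.
lra.
Qed.

(** Differentiating f' = h - b + x f twice gives f'' = h' + f + x f' and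
    f''' = h'' + 2 f' + x f'', so the maximum principle applies to f' and to
    - f'. *)
Lemma gauss_stein_derivative_bound (h h1 h2 : R -> R) (K : R) :
  (forall x : R, is_derive x 1 h (h1 x)) ->
  (forall x : R, is_derive x 1 h1 (h2 x)) ->
  (forall x, `|h2 x| <= K) ->
  exists f f1 (C : R), [/\
    forall x : R, is_derive x 1 f (f1 x),
    forall x, f1 x = h x - \int[mu]_t (h t * phi t) + x * f x,
    forall x, `|f x| <= C * (1 + `|x|) &
    forall x, `|f1 x| <= K / 2].
Proof.
move=> Dh Dh1 hK.
have K0 : 0 <= K by exact: le_trans (hK 0).
have ch := is_derive_continuous Dh.
have hB := quadratic_growth Dh Dh1 hK.
set B := _ + K in hB.
have B0 : 0 <= B by rewrite !addr_ge0.
set c := \int[mu]_t _.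
pose q x := h x - c.
have ih := integrableM_std_normal_pdf ch hB.
have iphi : mu.-integrable setT (EFin \o phi) by exact: integrable_normal_pdf.
have intphi : \int[mu]_t phi t = 1 by rewrite /Rintegral integral_normal_pdf.
have qphi0 : \int[mu]_x (q x * phi x) = 0.
  under eq_Rintegral do rewrite mulrBl.
  rewrite RintegralB//; last exact: (integrableZl measurableT c iphi).
  by rewrite RintegralZl// intphi mulr1 subrr.
have cq : continuous q by move=> x; apply: cvgB; [exact: ch|exact: cvg_cst].
have qB x : `|q x| <= (B + `|c|) * (1 + x ^+ 2).
  apply: le_trans (ler_normB _ _) _; rewrite mulrDl lerD//.
  by rewrite ler_peMr// lerDl sqr_ge0.
have [f [C [Df fC]]] := gauss_stein_solution cq qB qphi0.
pose f1 x := q x + x * f x.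
pose f2 x := h1 x + (1 * f x + x * f1 x).
have Dq (x : R) : is_derive x 1 q (h1 x).
  by rewrite -[h1 x]subr0; apply: is_deriveB.
have Df1 (x : R) : is_derive x 1 f1 (f2 x).
  by apply: is_deriveD; exact: is_derive1M.
have Df2 (x : R) : is_derive x 1 f2 (h2 x + (f1 x + (1 * f1 x + x * f2 x))).
  apply: is_deriveD; apply: is_deriveD; last exact: is_derive1M.
  by rewrite -[f1 x]mul1r; exact: is_derive1Ml.
have C0 : 0 <= C.
  by have := fC 0; rewrite normr0 addr0 mulr1; exact: le_trans.
have f1C x : `|f1 x| <= (B + `|c| + 2 * C) * (1 + x ^+ 2).
  apply: le_trans (ler_normD _ _) _; rewrite [leRHS]mulrDl lerD//.
  rewrite normrM; have := ler_wpM2l (normr_ge0 x) (fC x) => /le_trans; apply.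
  rewrite -[x ^+ 2]real_normK ?num_real//; have := normr_ge0 x.
  move: (`|x|) => X X0; have : 0 <= C * (X - 1) ^+ 2 by rewrite mulr_ge0 ?sqr_ge0.
  have : 0 <= C * X by rewrite mulr_ge0.
  have : 0 <= C * X ^+ 2 by rewrite mulr_ge0 ?sqr_ge0.
  lra.
exists f, f1, C; split => // x.
rewrite ler_norml; apply/andP; split; last first.
  apply: (ode_max_principle Df1 Df2 _ hK f1C) => y; rewrite /f2; ring.
rewrite lerNl.
apply: (@ode_max_principle _ (fun y => - f1 y) (fun y => - f2 y)
  (fun y => - (h2 y + (f1 y + (1 * f1 y + y * f2 y))))
  (fun y => - h2 y) K (B + `|c| + 2 * C)).
- by move=> y; rewrite /f2; ring.
- by move=> y; rewrite normrN.
- by move=> y; rewrite normrN.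
Qed.

End stein_bound.

(** * The Student Stein identity *)

Section student.
Context {R : realType}.
Notation mu := (@lebesgue_measure R).
Variable m : R.
Hypothesis hm : 4 < m.
Notation k := (student_kernel m).
Notation a := (Num.sqrt ((m - 2) / m)).

Let m0 : 0 < m. Proof. by move: hm; lra. Qed.

Let u (x : R) := 1 + x ^+ 2 / m.

Let u1 x : 1 <= u x.
Proof. by rewrite lerDl divr_ge0 ?sqr_ge0// ltW. Qed.

Let u0 x : 0 < u x. Proof. exact: lt_le_trans (u1 x). Qed.

Let le_oneDsqr_u (x : R) : 1 + x ^+ 2 <= m * u x.
Proof. by rewrite /u mulrDr mulr1 mulrC divfK ?gt_eqF// lerD2r; move: hm; lra. Qed.

Let Du (x : R) : is_derive x 1 u (m^-1 * (2 * x)).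
Proof.
rewrite /u -[X in is_derive _ _ _ X]add0r.
have -> : (fun y => 1 + y ^+ 2 / m) = (fun y => 1 + m^-1 * y ^+ 2).
  by apply/funext => y; rewrite mulrC.
exact: is_deriveD (is_derive1Ml m^-1 (is_derive1Xn 1 x)).
Qed.

Lemma student_kernel_gt0 x : 0 < k x.
Proof. by rewrite powR_gt0// u0. Qed.

(** With u = 1 + x^2/m >= 1, the exponent - (m + 1)/2 is at most - 2 and
    1 + x^2 <= m u. *)
Lemma student_kernel_decay x : k x * (1 + x ^+ 2) ^+ 2 <= m ^+ 2.
Proof.
have ku : k x <= (u x ^+ 2)^-1.
  rewrite -powR_invn ?(ltW (u0 x))//; apply: ler_powR; first exact: u1.
  by move: hm; lra.
apply: le_trans (_ : (u x ^+ 2)^-1 * (m * u x) ^+ 2 <= _).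
  apply: ler_pM => //; rewrite ?exprn_ge0 ?addr_ge0 ?sqr_ge0//.
    exact: ltW (student_kernel_gt0 x).
  have xu0 : 0 <= 1 + x ^+ 2 by rewrite addr_ge0 ?sqr_ge0.
  by apply: lerXn2r; rewrite ?nnegrE ?(le_trans xu0) ?le_oneDsqr_u.
by rewrite exprMn mulrCA mulVf ?mulr1// expf_neq0// gt_eqF.
Qed.

Lemma continuous_student_kernel : continuous k.
Proof.
apply: (@is_derive_continuous _ _
  (fun x => - ((m + 1) / 2) * u x `^ (- ((m + 1) / 2) - 1) * (m^-1 * (2 * x)))).
by move=> x; exact: is_derive1_comp (is_derive1_powR _ (u0 x)) (Du x).
Qed.

Lemma integrableM_student_kernel (g : R -> R) (C : R) : continuous g ->
  (forall x, `|g x| <= C * (1 + x ^+ 2)) ->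
  mu.-integrable setT (EFin \o (g \* k)).
Proof.
move=> cg gC; apply: integrableM_quartic_decay cg gC.
- exact: continuous_student_kernel.
- by move=> x; exact: ltW (student_kernel_gt0 x).
- exact: student_kernel_decay.
Qed.

Lemma integrable_student_kernel : mu.-integrable setT (EFin \o k).
Proof.
have k1 := @integrableM_student_kernel (cst 1) 1 (fun x => cvg_cst _).
have -> : EFin \o k = EFin \o (cst 1 \* k).
  by apply/funext => x /=; rewrite mul1r.
by apply: k1 => x; rewrite normr1 mul1r lerDl sqr_ge0.
Qed.

Lemma student_scale_sqr : a ^+ 2 = (m - 2) / m.
Proof. by rewrite sqr_sqrtr// divr_ge0 ?ltW//; move: hm; lra. Qed.

Lemma student_scale_le1 : 0 <= a <= 1.
Proof.
rewrite sqrtr_ge0/= -(@ler_pXn2r _ 2)// ?nnegrE ?sqrtr_ge0// student_scale_sqr.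
by rewrite expr1n ler_pdivrMr// mul1r lerBlDr lerDl.
Qed.

Lemma student_scaleM_le x : (a * x) ^+ 2 <= x ^+ 2.
Proof.
have /andP[a0 a1] := student_scale_le1.
by rewrite exprMn ler_piMl ?sqr_ge0// expr_le1.
Qed.

(** Stein identity of the rescaled Student law, written in the variable of T,
    with w = a x.  The integrand is the derivative of a multiple of
    u^(- (m - 1)/2) f(a x), where u = 1 + x^2/m: one more power of u than the
    kernel k = u^(- (m + 1)/2), and (u k)' = - ((m - 1)/m) x k. *)
Lemma student_stein (f f1 : R -> R) (C : R) :
  (forall x : R, is_derive x 1 f (f1 x)) -> continuous f1 ->
  (forall x, `|f x| <= C * (1 + `|x|)) -> (forall x, `|f1 x| <= C) ->
  let g x := (m - 2 + (a * x) ^+ 2) / (m - 1) * f1 (a * x)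
             - a * x * f (a * x) in
  mu.-integrable setT (EFin \o (g \* k)) /\ \int[mu]_x (g x * k x) = 0.
Proof.
move=> Df cf1 fC f1C g.
have /andP[a0 a1] := student_scale_le1.
have C0 : 0 <= C by exact: le_trans (f1C 0).
have cf := is_derive_continuous Df.
have cax : continuous (fun x : R => a * x).
  by move=> x; apply: cvgM; [exact: cvg_cst|exact: cvg_id].
have cfa : continuous (fun x : R => f (a * x)).
  by move=> x; apply: continuous_comp; [exact: cax|exact: cf].
have cf1a : continuous (fun x : R => f1 (a * x)).
  by move=> x; apply: continuous_comp; [exact: cax|exact: cf1].
pose b : R := - ((m - 1) / 2).
pose J x := u x `^ b * f (a * x).
have bk : b - 1 = - ((m + 1) / 2) by rewrite /b; field.
have ukb x : u x `^ b = u x * k x.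
  rewrite /student_kernel -bk powRB; last by rewrite (gt_eqF (u0 x)) implybT.
  by rewrite powRr1 ?(ltW (u0 x))// mulrCA divff ?mulr1// gt_eqF.
have DJ (x : R) : is_derive x 1 J
    (b * k x * (m^-1 * (2 * x)) * f (a * x) + u x `^ b * (f1 (a * x) * a)).
  rewrite /student_kernel -bk; apply: is_derive1M.
    exact: is_derive1_comp (is_derive1_powR _ (u0 x)) (Du x).
  apply: is_derive1_comp (Df _) _; rewrite -[X in is_derive _ _ _ X]mulr1.
  exact: is_derive1Ml.
(* The factor a m / (m - 1) normalises the coefficient of w f to 1; that of f'
   becomes (m - 2)/(m - 1) (1 + x^2/m), which is the Stein kernel at w. *)
have am : a * m / (m - 1) * a = (m - 2) / (m - 1).
  rewrite (_ : _ * a = a ^+ 2 * m / (m - 1)); last by ring.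
  rewrite student_scale_sqr.
  by field; apply/andP; split; rewrite gt_eqF//; move: hm; lra.
have m1 : m - 1 != 0 by rewrite gt_eqF//; move: hm; lra.
have mN0 : m != 0 by rewrite gt_eqF.
have norm_le2 t : `|t| * (C * (1 + `|t|)) <= 2 * C * (1 + t ^+ 2).
  rewrite -[t ^+ 2]real_normK ?num_real//; move: (`|t|) (normr_ge0 t) => X X0.
  have : 0 <= C * (X - 1) ^+ 2 by rewrite mulr_ge0 ?sqr_ge0.
  have : 0 <= C * X by rewrite mulr_ge0.
  have : 0 <= C * X ^+ 2 by rewrite mulr_ge0 ?sqr_ge0.
  by lra.
have Jx x : `|a * m / (m - 1) * J x| * `|x| <= a * m / (m - 1) * (2 * C * m ^+ 2).
  have am0 : 0 <= a * m / (m - 1).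
    by rewrite divr_ge0 ?mulr_ge0 ?(ltW m0)//; move: hm; lra.
  move: (a * m / (m - 1)) am0 => A am0.
  rewrite normrM (ger0_norm am0) -[leLHS]mulrA ler_wpM2l//.
  rewrite normrM ger0_norm ?powR_ge0// ukb.
  have ux : u x <= 1 + x ^+ 2.
    by rewrite lerD2l ler_pdivrMr// ler_peMr ?sqr_ge0//; move: hm; lra.
  have fx : `|f (a * x)| * `|x| <= 2 * C * (1 + x ^+ 2).
    apply: le_trans (norm_le2 x); rewrite mulrC ler_wpM2l//.
    apply: le_trans (fC _) _; rewrite ler_wpM2l// lerD2l normrM (ger0_norm a0).
    by rewrite ler_piMl.
  have k0 := ltW (student_kernel_gt0 x).
  rewrite -[leLHS]mulrA.
  apply: le_trans (_ : (1 + x ^+ 2) * k x * (2 * C * (1 + x ^+ 2)) <= _).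
    apply: ler_pM => //; last exact: ler_wpM2r.
    by rewrite mulr_ge0// (le_trans _ (u1 x)).
  have := ler_wpM2l (mulr_ge0 (ler0n R 2) C0) (student_kernel_decay x).
  by apply: le_trans; rewrite le_eqVlt; apply/orP; left; apply/eqP; ring.
have cg : continuous g.
  move=> x; apply: cvgB; last by apply: cvgM; [exact: cax|exact: cfa].
  apply: cvgM; last exact: cf1a.
  apply: cvgM; last exact: cvg_cst.
  apply: cvgD; first exact: cvg_cst.
  by apply: cvgM; exact: cax.
have ig : mu.-integrable setT (EFin \o (g \* k)).
  apply: (integrableM_student_kernel (C := 3 * C) cg) => x; rewrite /g.
  have wx := student_scaleM_le x; set w := a * x in wx *.
  apply: le_trans (ler_normB _ _) _.
  have -> : 3 * C * (1 + x ^+ 2) = (1 + x ^+ 2) * C + 2 * C * (1 + x ^+ 2) by ring.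
  apply: lerD.
    rewrite normrM ler_pM// ger0_norm.
      rewrite ler_pdivrMr; last by move: hm; lra.
      have : 0 <= (m - 2) * x ^+ 2 by rewrite mulr_ge0 ?sqr_ge0//; move: hm; lra.
      by move: hm wx; lra.
    by have := sqr_ge0 w => w20; apply: divr_ge0; move: hm w20; lra.
  rewrite normrM; have := ler_wpM2l (normr_ge0 w) (fC w) => /le_trans; apply.
  apply: le_trans (norm_le2 w) _.
  by rewrite ler_wpM2l ?mulr_ge0// lerD2l.
split=> //.
apply: (@Rintegral_derive_eq0 _ _ (fun x => a * m / (m - 1) * J x)).
- move=> x; apply: is_derive_eq (is_derive1Ml _ (DJ x)) _; rewrite /g.
  rewrite ukb exprMn student_scale_sqr /b /u.
  have -> : a * m / (m - 1) * (- ((m - 1) / 2) * k x * (m^-1 * (2 * x)) * f (a * x) +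
    (1 + x ^+ 2 / m) * k x * (f1 (a * x) * a)) =
    (- (a * x * f (a * x)) + (a * m / (m - 1) * a) * (1 + x ^+ 2 / m) * f1 (a * x)) * k x.
    by field; rewrite m1 mN0.
  by rewrite am; field; rewrite m1 mN0.
- by move=> x; apply: cvgM; [exact: cg|exact: continuous_student_kernel].
- exact: ig.
- exact: (cvg0_le_normM Jx).1.
- exact: (cvg0_le_normM Jx).2.
Qed.

End student.

(** * The Student and Gaussian integrals compared *)

Section student_normal.
Context {R : realType}.
Notation mu := (@lebesgue_measure R).
Notation phi := (@normal_pdf R 0 1).
Variables (m c : R).
Hypothesis hm : 4 < m.
Hypothesis c0 : 0 <= c.
Notation k := (student_kernel m).
Notation a := (Num.sqrt ((m - 2) / m)).

Let p (x : R) := c * k x.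
Hypothesis p1 : \int[mu]_x p x = 1.

Lemma integrableM_student_density (g : R -> R) (C : R) : continuous g ->
  (forall x, `|g x| <= C * (1 + x ^+ 2)) ->
  mu.-integrable setT (EFin \o (g \* p)).
Proof.
move=> cg gC; have := integrableZl measurableT c (integrableM_student_kernel hm cg gC).
by apply: eq_integrable => // x _; rewrite /p /= -EFinM mulrCA.
Qed.

Let cax : continuous (fun x : R => a * x).
Proof. by move=> x; apply: cvgM; [exact: cvg_cst|exact: cvg_id]. Qed.

Let ax_le C x : 0 <= C -> C * (1 + (a * x) ^+ 2) <= C * (1 + x ^+ 2).
Proof. by move=> C0; rewrite ler_wpM2l// lerD2l student_scaleM_le. Qed.

Let m1 : 0 < m - 1. Proof. by move: hm; lra. Qed.

Let p0 x : 0 <= p x.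
Proof. by rewrite mulr_ge0// ltW// student_kernel_gt0. Qed.

Let ip : mu.-integrable setT (EFin \o p).
Proof. exact: (integrableZl measurableT c (integrable_student_kernel hm)). Qed.

Let isq : mu.-integrable setT (EFin \o (fun x => (a * x) ^+ 2 * p x)).
Proof.
apply: (@integrableM_student_density (fun x => (a * x) ^+ 2) 1).
  by move=> x; apply: cvgM; exact: cax.
move=> x; rewrite mul1r ger0_norm ?sqr_ge0//.
by rewrite (le_trans (student_scaleM_le hm x))// lerDr.
Qed.

Let stein (f f1 : R -> R) (C : R) :
  (forall x : R, is_derive x 1 f (f1 x)) -> continuous f1 ->
  (forall x, `|f x| <= C * (1 + `|x|)) -> (forall x, `|f1 x| <= C) ->
  \int[mu]_x (((m - 2 + (a * x) ^+ 2) / (m - 1) * f1 (a * x)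
               - a * x * f (a * x)) * p x) = 0.
Proof.
move=> Df cf1 fC f1C; have [ig g0] := student_stein hm Df cf1 fC f1C.
under eq_Rintegral do rewrite mulrCA.
by rewrite RintegralZl// g0 mulr0.
Qed.

(** The Stein identity for f = id reads (m - 2 + E W^2) / (m - 1) = E W^2. *)
Lemma student_second_moment : \int[mu]_x ((a * x) ^+ 2 * p x) = 1.
Proof.
have le_id (x : R) : `|id x| <= 1 * (1 + `|x|) by rewrite mul1r lerDr.
have le_cst (x : R) : `|cst 1 x| <= 1 :> R by rewrite normr1.
have st := stein (fun x => is_derive_id x 1) (fun x => cvg_cst _) le_id le_cst.
have : (m - 2) / (m - 1) * (1 - \int[mu]_x ((a * x) ^+ 2 * p x)) = 0.
  rewrite -st -[X in _ * (X - _)]p1 -RintegralB// -RintegralZl//; last first.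
    exact: (integrableB measurableT ip isq).
  by apply: eq_Rintegral => x _ /=; field; rewrite gt_eqF.
move=> /eqP; rewrite mulf_eq0 subr_eq0 gt_eqF/=; first by move=> /eqP <-.
by rewrite divr_gt0//; move: hm; lra.
Qed.

Lemma student_normal_distance (h h1 h2 : R -> R) (K : R) :
  (forall x : R, is_derive x 1 h (h1 x)) ->
  (forall x : R, is_derive x 1 h1 (h2 x)) ->
  (forall x, `|h2 x| <= K) ->
  `|\int[mu]_x (h (a * x) * p x) - \int[mu]_x (h x * phi x)| <= K / (m - 1).
Proof.
move=> Dh Dh1 hK.
have K0 : 0 <= K by exact: le_trans (hK 0).
have [f [f1 [C [Df f1E fC f1K]]]] := gauss_stein_derivative_bound Dh Dh1 hK.
set b := \int[mu]_x (h x * phi x) in f1E *.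
have ch := is_derive_continuous Dh.
have cf := is_derive_continuous Df.
have hB := quadratic_growth Dh Dh1 hK.
set B := _ + K in hB.
have B0 : 0 <= B by rewrite !addr_ge0.
have cf1 : continuous f1.
  have -> : f1 = (fun x => h x - b + x * f x) by exact/funext.
  move=> x; apply: cvgD; last by apply: cvgM; [exact: cvg_id|exact: cf].
  by apply: cvgB; [exact: ch|exact: cvg_cst].
have C0 : 0 <= C.
  by have := fC 0; rewrite normr0 addr0 mulr1; exact: le_trans.
have stein0 : \int[mu]_x (((m - 2 + (a * x) ^+ 2) / (m - 1) * f1 (a * x)
    - a * x * f (a * x)) * p x) = 0.
  apply: (stein (C := C + K / 2)) => // x.
    apply: le_trans (fC x) _; rewrite ler_wpM2r ?addr_ge0// lerDl.
    by rewrite divr_ge0.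
  by rewrite (le_trans (f1K x))// lerDr.
have ih : mu.-integrable setT (EFin \o (fun x => h (a * x) * p x)).
  apply: (@integrableM_student_density (fun x => h (a * x)) B).
    by move=> x; apply: continuous_comp; [exact: cax|exact: ch].
  by move=> x; rewrite (le_trans (hB _))// ax_le.
pose r x := f1 (a * x) * (1 - (a * x) ^+ 2).
have ir : mu.-integrable setT (EFin \o (fun x => r x * p x)).
  apply: (@integrableM_student_density r (K / 2)).
    move=> x; apply: cvgM; first by apply: continuous_comp; [exact: cax|exact: cf1].
    by apply: cvgB; [exact: cvg_cst|apply: cvgM; exact: cax].
  move=> x; apply: le_trans (ax_le _ _); last by rewrite divr_ge0.
  rewrite normrM ler_pM//; apply: le_trans (ler_normB _ _) _.
  by rewrite normr1 ger0_norm// sqr_ge0.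
have ibp : mu.-integrable setT (EFin \o (fun x => b * p x)).
  exact: (integrableZl measurableT b ip).
have irZ : mu.-integrable setT (EFin \o (fun x => (m - 1)^-1 * (r x * p x))).
  exact: (integrableZl measurableT (m - 1)^-1 ir).
(* By the Stein equation h - b = f' - w f, and subtracting the Student identity
   leaves f' (1 - tau) = f' (1 - w^2) / (m - 1). *)
have -> : \int[mu]_x (h (a * x) * p x) - b = (m - 1)^-1 * \int[mu]_x (r x * p x).
  have {1}-> : b = \int[mu]_x (b * p x) by rewrite RintegralZl// p1 mulr1.
  rewrite -RintegralB// -RintegralZl//.
  apply/eqP; rewrite -subr_eq0 -RintegralB//; last exact: (integrableB measurableT ih ibp).
  rewrite -[X in _ == X]stein0; apply/eqP/eq_Rintegral => x _.
  by rewrite /r f1E; field; rewrite gt_eqF.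
rewrite normrM gtr0_norm ?invr_gt0// mulrC ler_pM2r ?invr_gt0//.
apply: le_trans (le_normr_Rintegral measurableT ir) _.
have i2 : mu.-integrable setT (EFin \o (fun x => p x + (a * x) ^+ 2 * p x)).
  exact: (integrableD measurableT ip isq).
have i3 : mu.-integrable setT
    (EFin \o (fun x => K / 2 * (p x + (a * x) ^+ 2 * p x))).
  exact: (integrableZl measurableT (K / 2) i2).
apply: (@le_trans _ _ (\int[mu]_x (K / 2 * (p x + (a * x) ^+ 2 * p x)))).
  apply: le_Rintegral => //; first exact: integrable_norm.
  move=> x _; rewrite normrM (ger0_norm (p0 x)).
  rewrite -[X in _ * (X + _)]mul1r -mulrDl mulrA ler_wpM2r//.
  rewrite normrM ler_pM//; apply: le_trans (ler_normB _ _) _.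
  by rewrite normr1 ger0_norm// sqr_ge0.
rewrite RintegralZl// RintegralD// student_second_moment p1.
by rewrite le_eqVlt; apply/orP; left; apply/eqP; field.
Qed.

End student_normal.

(** * The distance between the expectations *)

Lemma is_derive_derive1 (R : realType) (g : R -> R) :
  (forall x : R, derivable g x 1) -> forall x : R, is_derive x 1 g (g^`() x).
Proof. by move=> dg x; rewrite derive1E; exact: derivableP. Qed.

Lemma supnorm_ge0 (R : realType) (g : R -> R) : (0 <= supnorm g)%E.
Proof.
apply: (@le_trans _ _ (`|g 0|%:E)); first by rewrite lee_fin.
by apply: ereal_sup_ubound; exists 0.
Qed.

Lemma supnorm_fin_le (R : realType) (g : R -> R) (K : R) :
  supnorm g = K%:E -> forall x, `|g x| <= K.
Proof.
move=> gK x; rewrite -lee_fin -gK.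
by apply: ereal_sup_ubound; exists x.
Qed.

Theorem proposition11 (R : realType)
    (d : measure_display) (Omega : measurableType d) (P : probability Omega R)
    (d' : measure_display) (Omega' : measurableType d')
    (Q : probability Omega' R)
    (m : R) (hm : 4 < m)
    (T : {RV P >-> R}) (hT : student_distributed m T)
    (W : Omega -> R) (hW : forall w, W w = Num.sqrt ((m - 2) / m) * T w)
    (Z : {RV Q >-> R}) (hZ : std_normal_distributed Z)
    (h : R -> R)
    (h_diff : forall x : R, derivable h x 1)
    (h'_diff : forall x : R, derivable h^`() x 1)
    (h'_ac : abs_continuous h^`()) :
  (`| 'E_P[h \o W] - 'E_Q[h \o Z] |
     <= (2 / (m - 4))%:E * supnorm h^`()^`())%E.
Proof.
have m4 : 0 < 2 / (m - 4) by rewrite divr_gt0// subr_gt0.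
have := supnorm_ge0 h^`()^`().
case EK : (supnorm h^`()^`()) => [K| |//] K0; last by rewrite gt0_muley ?lte_fin// leey.
rewrite lee_fin in K0.
have hK := supnorm_fin_le EK.
have Dh := is_derive_derive1 h_diff.
have Dh1 := is_derive_derive1 h'_diff.
have ch := is_derive_continuous Dh.
have hB := quadratic_growth Dh Dh1 hK.
have [c c0 Tp] := hT.
set a := Num.sqrt _ in hW.
pose p x := c * student_kernel m x.
have cha : continuous (fun x => h (a * x)).
  move=> x; apply: continuous_comp; last exact: ch.
  by apply: cvgM; [exact: cvg_cst|exact: cvg_id].
have hBa x : `|h (a * x)| <=
    (`|h 0| + `|h^`() 0| + K) * (1 + x ^+ 2).
  apply: le_trans (hB _) _.
  by rewrite ler_wpM2l ?addr_ge0// lerD2l student_scaleM_le.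
have p0 x : 0 <= p x.
  by apply: mulr_ge0; [exact: ltW|exact: ltW (student_kernel_gt0 hm x)].
have ip : (@lebesgue_measure R).-integrable setT (EFin \o p).
  exact: (integrableZl measurableT c (integrable_student_kernel hm)).
have p1 : \int[lebesgue_measure]_x p x = 1.
  by rewrite /Rintegral -Tp// probability_setT.
have EW : ('E_P[h \o W] = (\int[lebesgue_measure]_x (h (a * x) * p x))%R%:E)%E.
  have -> : h \o W = (fun x => h (a * x)) \o T by apply/funext => w /=; rewrite hW.
  apply: (expectation_density p0 ip Tp).
    exact: continuous_measurable_fun.
  exact: integrableM_student_density hBa.
have EZ : ('E_Q[h \o Z] =
    (\int[lebesgue_measure]_x (h x * normal_pdf 0 1 x))%R%:E)%E.
  apply: (expectation_density _ _ hZ).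
  - by move=> x; exact: normal_pdf_ge0.
  - exact: integrable_normal_pdf.
  - exact: continuous_measurable_fun.
  - exact: integrableM_std_normal_pdf hB.
rewrite EW EZ -EFinM -EFinB lee_fin.
apply: le_trans (student_normal_distance hm (ltW c0) p1 Dh Dh1 hK) _.
rewrite mulrC ler_wpM2r//.
have m1 : 0 < m - 1 by lra.
rewrite -[leLHS]mul1r ler_pdivrMr// mulrAC ler_pdivlMr ?subr_gt0//; lra.
Qed.
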